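(* In the Best-2 case of the Sliding-Window Secretary Problem with $N$ applicants, window size $K$ and (possibly non-optimal) thresholds $d_1\le d_2$, let $q=\left\lceil\frac{a-d_1}{K}\right\rceil$ and $s=\left\lceil\frac{a-d_2}{K}\right\rceil$. Then, for $s>0$ (in the first two formulas) and for $q>0$ (in the third), $$\sigma_1(a)=\sigma_1(d_2+(s-1)K)+\sum_{i=d_2+(s-1)K+1}^{a}\frac{d_1}{N}\left(\frac{1}{N-1}\right)\left(1-c(i)\right),$$ $$\sigma_2(a)=\sigma_2(d_2+(s-1)K)+\sum_{i=d_2+(s-1)K+1}^{a}\frac{d_1}{N}\left(\frac{1}{N-1}\right)\left(1-c(i)\right),$$ $$\sigma_3(a)=\sigma_3(d_1+(q-1)K)+\sum_{i=d_1+(q-1)K+1}^{a}2\left(\frac{N-i}{N(N-1)}\right)\left(1-t(i)\right).$$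
   Context: Setting (Best-2 case). $N$ applicants with distinct ranks ($1$ is the best) are seen sequentially at indices $1,\dots,N$, and every permutation of ranks is equally likely. The interviewer knows $N$, can discern only the relative ranks of the applicants seen so far, makes one choice, and wins if and only if the chosen applicant is one of the top two overall. The interviewer can choose any of the last $K$ applicants, for a fixed $K$: the window is the set of $K$ consecutive applicants that can be chosen, and the applicant at its smallest index must be accepted or rejected before a new applicant can be interviewed. Thus when the window starts at index $i$, the interviewer has seen $i+K-1$ applicants. A 1-candidate is a candidate (an applicant in the current window with nonzero probability of winning if chosen, from the interviewer's perspective) that is the best out of all seen applicants; a 2-candidate is a candidate that is the second best out of all seen applicants. Under the sliding rule, the interviewer rejects applicants until the best candidate in the window is at the window's first index. Strategy with thresholds $d_1,d_2$: reject the first $d_1$ applicants, choose the first 1-candidate after $d_1$ with the sliding rule, and choose the first 1- or 2-candidate after $d_2$ with the sliding rule. Stopping probabilities. With $s=\lceil (a-d_2)/K\rceil$: $h_s(a)$ is the probability of stopping at a 2-candidate between $d_2+(s-1)K+1$ and $a$ given that the best applicant that the interviewer has interviewed is between $1$ and $d_1$; $g_s(a)$ is the probability of stopping at a 2-candidate between $d_2+(s-1)K+1$ and $a$. With $q=\lceil (a-d_1)/K\rceil$: $f_q(a)$ is the probability that the interviewer stops at a 1-candidate between $d_1+(q-1)K+1$ and $a$. For $q\le 0$, $f$ is $0$, and for $s\le 0$, $g$ and $h$ are both $0$. Further, $$c(i)=\sum_{r=-1}^{\lceil\frac{i-d_2}{K}\rceil-2}h_r(d_2+rK)+h_{\lceil\frac{i-d_2}{K}\rceil-1}(i-K),$$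 $$t(i)=\sum_{r=-1}^{\lceil\frac{i-d_1}{K}\rceil-2}f_r(d_1+rK)+f_{\lceil\frac{i-d_1}{K}\rceil-1}(i-K)+\sum_{r=-1}^{\lceil\frac{i-d_2}{K}\rceil-2}g_r(d_2+rK)+g_{\lceil\frac{i-d_2}{K}\rceil-1}(i-K).$$ Winning probabilities. Let $j_1$ and $j_2$ be the indices of the best and second best applicants, respectively. Subcases: (i) $j_1\le d_1$ and $j_2>d_2$; (ii) $j_2\le d_1$ and $j_1>d_1$; (iii) $j_1>d_1$ and $j_2>d_1$. For $l=1,2,3$, $\sigma_l(a)$ is the probability of winning with a candidate between $1$ and $a$ for subcase (i), (ii), (iii), respectively. For $a\le d_2$, $\sigma_1(a)=0$, because 2-candidates before $d_2$ are not chosen; for $a\le d_1$, $\sigma_2(a)=\sigma_3(a)=0$, because candidates before $d_1$ are not chosen.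
   Formalization: σ_3(a) is taken as the probability of winning in subcase (iii) with min(j_1,j_2) ≤ a, not with the chosen applicant's index ≤ a; the literal reading fails for K ≥ 2 (N=3, K=2, d_1=d_2=1, a=2: 1/6 versus 1/3). Both readings agree for K=1 and for a=N. *)

(* Defs.v *)
From HB Require Import structures.
From mathcomp Require Import all_boot all_order all_fingroup all_algebra.

Set Implicit Arguments.
Unset Strict Implicit.
Unset Printing Implicit Defensive.

Import Order.TTheory GRing.Theory Num.Theory.
Local Open Scope ring_scope.

Definition Pr (N : nat) (E : pred 'S_N) : rat :=
  #|[set p | E p]|%:R / #|[set: 'S_N]|%:R.

(* Conditional probability; equal to 0 when the condition F has probability 0. *)
Definition cPr (N : nat) (E F : pred 'S_N) : rat :=
  Pr (fun p => E p && F p) / Pr F.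

(* The positions 'I_N are numbered from 0, indices and ranks from 1.  For
   p : 'S_N, the applicant at position i has overall rank (p i).+1. *)
Definition idx (N : nat) (i : 'I_N) : int := i.+1%:Z.

Definition rank (N : nat) (p : 'S_N) (i : 'I_N) : nat := (p i).+1.

Definition index_of_rank (N : nat) (p : 'S_N) (r : nat) : int :=
  if [pick i | rank p i == r] is Some i then idx i else 0.

Definition j1 (N : nat) (p : 'S_N) : int := index_of_rank p 1.
Definition j2 (N : nat) (p : 'S_N) : int := index_of_rank p 2.

Definition top_two (N : nat) (p : 'S_N) (i : 'I_N) : bool := (rank p i <= 2)%N.

(* Applicants in the window, respectively seen so far, when the window starts
   at index x.  Both are truncated at N: once all N applicants have been seen
   the start keeps moving and the window shrinks. *)
Definition window (N K : nat) (x : int) : {set 'I_N} :=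
  [set i | x <= idx i <= x + K%:Z - 1].

Definition seen (N K : nat) (x : int) : {set 'I_N} :=
  [set i | idx i <= x + K%:Z - 1].

Definition rank_among (N : nat) (p : 'S_N) (A : {set 'I_N}) (i : 'I_N) : nat :=
  #|[set j in A | (rank p j < rank p i)%N]|.+1.

Definition same_order (N : nat) (A : {set 'I_N}) (p p' : 'S_N) : bool :=
  [forall i in A, forall j in A,
     (rank p i < rank p j)%N == (rank p' i < rank p' j)%N].

(* The interviewer's information is the relative order of the seen applicants. *)
Definition candidate (N K : nat) (p : 'S_N) (x : int) (i : 'I_N) : bool :=
  (i \in window N K x) &&
  (0 < cPr (fun p' => top_two p' i) (same_order (seen N K x) p)).

Definition r_candidate (N K r : nat) (p : 'S_N) (x : int) (i : 'I_N) : bool :=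
  candidate K p x i && (rank_among p (seen N K x) i == r).

Definition sliding_rule (N K : nat) (p : 'S_N) (w : 'I_N) : bool :=
  candidate K p (idx w) w &&
  [forall i, candidate K p (idx w) i ==> (rank p w <= rank p i)%N].

(* Applicant w is chosen if the window ever starts at w. *)
Definition accepts (N K d1 d2 : nat) (p : 'S_N) (w : 'I_N) : bool :=
  sliding_rule K p w &&
  ((d1%:Z < idx w) && r_candidate K 1 p (idx w) w
   || (d2%:Z < idx w)
      && (r_candidate K 1 p (idx w) w || r_candidate K 2 p (idx w) w)).

Definition stops_at (N K d1 d2 : nat) (p : 'S_N) (w : 'I_N) : bool :=
  accepts K d1 d2 p w && [forall v, (idx v < idx w) ==> ~~ accepts K d1 d2 p v].

Definition stops_at_r_candidate (N K d1 d2 r : nat) (lo hi : int)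
    (p : 'S_N) : bool :=
  [exists w, [&& stops_at K d1 d2 p w, r_candidate K r p (idx w) w
               & lo <= idx w <= hi]].

(* The best applicant seen when the window starts at x has index at most d. *)
Definition best_seen_by (N K d : nat) (x : int) (p : 'S_N) : bool :=
  [exists i in seen N K x,
     (rank_among p (seen N K x) i == 1) && (idx i <= d%:Z)].

Definition ceil_div (x : int) (K : nat) : int := Num.ceil (x%:~R / K%:R : rat).

(* The integers lo, lo + 1, .., hi; empty if hi < lo. *)
Definition irange (lo hi : int) : seq int :=
  if hi < lo then [::] else [seq lo + k%:Z | k <- iota 0 `|hi - lo|.+1].

Definition h (N K d1 d2 : nat) (s a : int) : rat :=
  if s <= 0 then 0
  else cPr (@stops_at_r_candidate N K d1 d2 2 (d2%:Z + (s - 1) * K%:Z + 1) a)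
           (@best_seen_by N K d1 a).

Definition g (N K d1 d2 : nat) (s a : int) : rat :=
  if s <= 0 then 0
  else Pr (@stops_at_r_candidate N K d1 d2 2 (d2%:Z + (s - 1) * K%:Z + 1) a).

Definition f (N K d1 d2 : nat) (q a : int) : rat :=
  if q <= 0 then 0
  else Pr (@stops_at_r_candidate N K d1 d2 1 (d1%:Z + (q - 1) * K%:Z + 1) a).

Definition c (N K d1 d2 : nat) (i : int) : rat :=
  \sum_(r <- irange (-1) (ceil_div (i - d2%:Z) K - 2))
     h N K d1 d2 r (d2%:Z + r * K%:Z)
  + h N K d1 d2 (ceil_div (i - d2%:Z) K - 1) (i - K%:Z).

Definition t (N K d1 d2 : nat) (i : int) : rat :=
  \sum_(r <- irange (-1) (ceil_div (i - d1%:Z) K - 2))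
     f N K d1 d2 r (d1%:Z + r * K%:Z)
  + f N K d1 d2 (ceil_div (i - d1%:Z) K - 1) (i - K%:Z)
  + \sum_(r <- irange (-1) (ceil_div (i - d2%:Z) K - 2))
     g N K d1 d2 r (d2%:Z + r * K%:Z)
  + g N K d1 d2 (ceil_div (i - d2%:Z) K - 1) (i - K%:Z).

Definition wins_choosing_by (N K d1 d2 : nat) (a : int) (p : 'S_N) : bool :=
  [exists w, [&& stops_at K d1 d2 p w, top_two p w & 1 <= idx w <= a]].

Definition wins (N K d1 d2 : nat) (p : 'S_N) : bool :=
  [exists w, stops_at K d1 d2 p w && top_two p w].

Definition sigma1 (N K d1 d2 : nat) (a : int) : rat :=
  Pr (fun p : 'S_N =>
        (j1 p <= d1%:Z) && (j2 p > d2%:Z) && wins_choosing_by K d1 d2 a p).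

Definition sigma2 (N K d1 d2 : nat) (a : int) : rat :=
  Pr (fun p : 'S_N =>
        (j2 p <= d1%:Z) && (j1 p > d1%:Z) && wins_choosing_by K d1 d2 a p).

(* When both top-two applicants come after d1, a win is counted at the index of
   the first of them, even if the sliding rule then passes it over in favour of
   the other one in the same window.  Counting at the index of the chosen
   applicant gives a different function of a as soon as K > 1: for N = K = 2
   and d1 = d2 = 0 it is 1/2 at a = 1, while the first summand is
   2 * (N - 1) / (N * (N - 1)) = 1. *)
Definition sigma3 (N K d1 d2 : nat) (a : int) : rat :=
  Pr (fun p : 'S_N =>
        [&& j1 p > d1%:Z, j2 p > d1%:Z, wins K d1 d2 p
          & 1 <= Num.min (j1 p) (j2 p) <= a]).

(* Main.v *)
(* The relative order of the applicants seen so far is independent of every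
   event that is invariant under permuting them, since a permutation turns a
   given order into any other.  Whether the interviewer stops at w depends only
   on the order of the first w + K - 1 applicants.  Hence the probability of
   stopping at w, given that the best applicant seen lies in 1..d1, is the same
   for all windows starting at or after w, and the chunks of h, f and g add up:
   c(i) is the conditional and t(i) the unconditional probability of having
   stopped at or before i - K.
   On the other hand, a top-two applicant at i blocks every w in (i - K, i) that
   ranks behind it, so the interviewer wins exactly if there was no stop at or
   before i - K, where i is the relevant top-two index.  This depends only on
   the order of the first i - 1 applicants, whereas the location of the top two
   is symmetric in them (for sigma_1 and sigma_2 once the order event that the
   best applicant seen lies in 1..d1 is split off). *)
Require Import Defs.
From HB Require Import structures.
From mathcomp Require Import all_boot all_order all_fingroup all_algebra.
From mathcomp Require Import zify ring.

Set Implicit Arguments.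
Unset Strict Implicit.
Unset Printing Implicit Defensive.

Import Order.TTheory GRing.Theory Num.Theory.
Local Open Scope ring_scope.

Lemma PrE N (E : pred 'S_N) :
  Pr E = (\sum_(p : 'S_N) E p)%N%:R / #|[set: 'S_N]|%:R.
Proof.
rewrite /Pr -sum1_card big_mkcond /=; congr (_%:R / _).
by apply: eq_bigr => p _; rewrite inE; case: (E p).
Qed.

Lemma card_perms_gt0 N : 0 < #|[set: 'S_N]|%:R :> rat.
Proof. by rewrite ltr0n; apply/card_gt0P; exists 1%g. Qed.

Lemma eq_Pr N (E F : pred 'S_N) : E =1 F -> Pr E = Pr F.
Proof. by move=> EF; rewrite !PrE; under eq_bigr do rewrite EF. Qed.

Lemma PrT N (E : pred 'S_N) : (forall p, E p) -> Pr E = 1.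
Proof.
move=> ET; rewrite /Pr (_ : [set p | E p] = [set: 'S_N]).
  by rewrite divff// gt_eqF// card_perms_gt0.
by apply/setP=> p; rewrite !inE ET.
Qed.

Lemma Pr_eq0 N (E : pred 'S_N) : (forall p, ~~ E p) -> Pr E = 0.
Proof.
move=> E0; rewrite PrE big1 ?mul0r// => p _.
by rewrite (negbTE (E0 p)).
Qed.

Lemma Pr_gt0 N (E : pred 'S_N) p : E p -> 0 < Pr E.
Proof.
move=> Ep; rewrite divr_gt0 ?card_perms_gt0// ltr0n.
by apply/card_gt0P; exists p; rewrite inE.
Qed.

Lemma PrD N (E E1 E2 : pred 'S_N) :
  (forall p, E p = (E1 p + E2 p)%N :> nat) -> Pr E = Pr E1 + Pr E2.
Proof.
move=> ED; rewrite !PrE -mulrDl -natrD -big_split; congr (_%:R / _).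
by apply: eq_bigr => p _; rewrite ED.
Qed.

Lemma Pr_sum N (I : finType) (P : pred I) (E : pred 'S_N) (F : I -> pred 'S_N) :
  (forall p, E p = (\sum_(i | P i) F i p)%N :> nat) ->
  Pr E = \sum_(i | P i) Pr (F i).
Proof.
move=> EF; under [RHS]eq_bigr do rewrite PrE.
rewrite -mulr_suml -natr_sum exchange_big PrE; congr (_%:R / _).
by apply: eq_bigr => p _; rewrite EF.
Qed.

Lemma sum_nat_bool1 (I : finType) (P b : pred I) i0 :
  (forall i, b i -> i = i0) -> (\sum_(i | P i) b i)%N = P i0 && b i0 :> nat.
Proof.
move=> bi0; rewrite big_mkcond (bigD1 i0)//= big1 ?addn0.
  by case: (P i0).
move=> i ne; case: (P i) => //; case bi: (b i) => //.
by rewrite (bi0 _ bi) eqxx in ne.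
Qed.

Definition order_event N (A : {set 'I_N}) (E : pred 'S_N) :=
  forall p p', same_order A p p' -> E p = E p'.

Definition exchangeable N (A : {set 'I_N}) (F : pred 'S_N) :=
  forall s p, perm_on A s -> F (s * p)%g = F p.

Lemma exchangeable_of_imp N (A : {set 'I_N}) (F : pred 'S_N) :
  (forall s p, perm_on A s -> F (s * p)%g -> F p) -> exchangeable A F.
Proof.
move=> imp s p sA; apply/idP/idP; first exact: imp.
by rewrite -{1}(mulKg s p); apply: imp; apply: perm_onV.
Qed.

Lemma same_orderP N (A : {set 'I_N}) (p p' : 'S_N) :
  reflect {in A &, forall i j, (p i < p j)%N = (p' i < p' j)%N}
          (same_order A p p').
Proof.
apply: (iffP forall_inP) => [so i j iA jA|so i iA].
  by have /forall_inP /(_ _ jA) /eqP := so _ iA; rewrite /rank !ltnS.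
by apply/forall_inP=> j jA; rewrite /rank !ltnS so.
Qed.

Lemma same_order_refl N (A : {set 'I_N}) (p : 'S_N) : same_order A p p.
Proof. exact/same_orderP. Qed.

Lemma same_order_sub N (A B : {set 'I_N}) (p p' : 'S_N) :
  A \subset B -> same_order B p p' -> same_order A p p'.
Proof.
move=> /subsetP AB /same_orderP so; apply/same_orderP=> i j iA jA.
by apply: so; apply: AB.
Qed.

Lemma exists_reordering N (A : {set 'I_N}) (p p' : 'S_N) :
  exists2 s : 'S_N, perm_on A s & same_order A (s * p)%g p'.
Proof.
have [n] := ubnP #|A|; elim: n A p => // n IHn A p; rewrite ltnS => leAn.
have [->|[x xA]] := set_0Vmem A.
  by exists 1%g; [exact: perm_on1 | apply/same_orderP=> i j; rewrite inE].
pose a := [arg max_(i > x in A) (p' i : nat)]%N.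
have [aA amax] : a \in A /\ {in A, forall i, (p' i <= p' a)%N}.
  by rewrite /a; case: arg_maxnP.
pose b := [arg max_(i > x in A) (p i : nat)]%N.
have [bA bmax] : b \in A /\ {in A, forall i, (p i <= p b)%N}.
  by rewrite /b; case: arg_maxnP.
have sabA : perm_on A (tperm a b).
  by apply/subsetP=> i; rewrite !inE; case: tpermP => [->|->|_ _ /eqP].
have [|s sA /same_orderP so] := IHn (A :\ a) (tperm a b * p)%g.
  by move: leAn; rewrite (cardsD1 a) aA.
have sA' : perm_on A s by apply: subset_trans sA (subsetDl _ _).
exists (s * tperm a b)%g; first exact: perm_onM.
have sa : s a = a by apply: (out_perm sA); rewrite !inE eqxx.
have top : {in A, forall i,
    ((s * (tperm a b * p))%g i <= (s * (tperm a b * p))%g a)%N}.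
  move=> i iA; rewrite !permM sa tpermL; apply: bmax.
  by rewrite !perm_closed.
have lt_top (q : 'S_N) i : {in A, forall j, (q j <= q a)%N} -> i \in A ->
    (q i < q a)%N = (i != a).
  move=> qmax iA; rewrite ltn_neqAle qmax// andbT.
  by congr (~~ _); apply/eqP/eqP=> [/val_inj/perm_inj|->].
rewrite -mulgA; apply/same_orderP=> i j iA jA.
have [->|ja] := eqVneq j a; first by rewrite !lt_top.
have [->|ia] := eqVneq i a.
  by rewrite !ltnNge top// amax.
by apply: so; rewrite !inE ?ia ?ja.
Qed.

Lemma order_event_exchangeable_indep N (A : {set 'I_N}) (E F : pred 'S_N) :
  order_event A E -> exchangeable A F ->
  Pr (fun p => E p && F p) = Pr E * Pr F.
Proof.
move=> oE xF.
pose T p := (\sum_(s : 'S_N | perm_on A s) E (s * p)%g)%N.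
have T_const p p' : T p = T p'.
  have [s0 s0A so] := exists_reordering A p p'.
  rewrite /T (reindex_inj (mulIg s0)) /=; apply: eq_big => s.
    apply/idP/idP=> sA; last exact: perm_onM.
    by rewrite -(mulgK s0 s); apply: perm_onM => //; exact: perm_onV.
  move=> s0s; rewrite -mulgA; congr nat_of_bool; apply: oE.
  have sA : perm_on A s.
    by rewrite -(mulgK s0 s); apply: perm_onM => //; exact: perm_onV.
  move: (s0 * p)%g so => p0 /same_orderP so; apply/same_orderP=> i j iA jA.
  by rewrite !permM so ?perm_closed.
pose H := (\sum_(s : 'S_N | perm_on A s) 1)%N.
have HF (G : pred 'S_N) : exchangeable A G ->
    (H * \sum_(p : 'S_N) (E p && G p) = T 1%g * \sum_(p : 'S_N) G p)%N.
  move=> xG; rewrite [RHS]big_distrr [LHS]big_distrl /=.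
  under [RHS]eq_bigr => p _ do
    rewrite (T_const _ p) /T big_distrl.
  rewrite [RHS]exchange_big /=; apply: eq_bigr => s sA; rewrite mul1n.
  rewrite (reindex_inj (mulgI s)); apply: eq_bigr => p _.
  by rewrite xG// mulnb.
have H0 : (0 < H)%N.
  by rewrite /H (bigD1 1%g) ?perm_on1.
have := HF F xF; have := HF xpredT (fun _ _ _ => erefl).
rewrite sum1_card -cardsT !PrE.
under eq_bigr do rewrite andbT.
have := card_perms_gt0 N.
set n := #|_|; set e := (\sum_p E p)%N; set f := (\sum_p F p)%N.
set ef := (\sum_p _)%N => n0.
move=> /(congr1 (fun k => k%:R : rat)) + /(congr1 (fun k => k%:R : rat)).
have HR : H%:R != 0 :> rat by rewrite pnatr_eq0 -lt0n.
rewrite !natrM => h1 h2.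
have n0' : n%:R != 0 :> rat by rewrite gt_eqF.
apply: (mulfI HR); rewrite mulrA h2 [H%:R * _]mulrA [H%:R * _]mulrA h1.
by rewrite mulfK// mulrA.
Qed.

Definition best_in N (A D : {set 'I_N}) (p : 'S_N) : bool :=
  [exists i in A :&: D, [forall j in A, (p i <= p j)%N]].

Lemma best_inP N (A D : {set 'I_N}) (p : 'S_N) :
  reflect (exists i, [/\ i \in A, i \in D & {in A, forall j, (p i <= p j)%N}])
          (best_in A D p).
Proof.
apply: (iffP exists_inP) => [[i /setIP[iA iD] /forall_inP]|[i [iA iD im]]].
  by exists i.
by exists i; [apply/setIP | apply/forall_inP].
Qed.

Lemma best_in_order_event N (A D : {set 'I_N}) : order_event A (best_in A D).
Proof.
suff imp p p' : same_order A p p' -> best_in A D p -> best_in A D p'.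
  move=> p p' so; apply/idP/idP; apply: imp => //.
  by apply/same_orderP=> i j iA jA; rewrite (same_orderP _ _ _ so).
move=> /same_orderP so /best_inP[i [iA iD im]]; apply/best_inP.
by exists i; split=> // j jA; rewrite leqNgt -so// -leqNgt im.
Qed.

Lemma best_in_exchangeable N (A B : {set 'I_N}) :
  A \subset B -> exchangeable A (best_in B A).
Proof.
move=> /subsetP AB.
apply: exchangeable_of_imp => s p sA /best_inP[i [iB iA im]].
have sB : perm_on B s by apply: subset_trans sA _; apply/subsetP.
have siA : s i \in A by rewrite perm_closed.
apply/best_inP; exists (s i); split; rewrite ?AB// => j jB.
have := im (s^-1 j)%g; rewrite !permM permKV; apply.
by rewrite perm_closed ?perm_onV.
Qed.

Lemma best_in_sub N (A B D : {set 'I_N}) (p : 'S_N) :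
  A \subset B -> B :&: D \subset A ->
  best_in B D p = best_in A D p && best_in B A p.
Proof.
move=> /subsetP AB /subsetP BDA; apply/best_inP/andP.
  move=> [i [iB iD im]]; have iA : i \in A by apply: BDA; apply/setIP.
  by split; apply/best_inP; exists i; split=> // j /AB; apply: im.
move=> [/best_inP[i [iA iD im]] /best_inP[j [jB jA jm]]].
have ij : i = j.
  by apply: (@perm_inj _ p); apply/val_inj/eqP; rewrite eqn_leq im// jm// AB.
by exists j; rewrite -{2}ij.
Qed.

Lemma cPr_best_in_sub N (A B D : {set 'I_N}) (E : pred 'S_N) :
  A \subset B -> B :&: D \subset A -> order_event A E ->
  Pr (best_in B D) != 0 -> cPr E (best_in B D) = cPr E (best_in A D).
Proof.
move=> AB BDA oE.
have xB := best_in_exchangeable AB.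
rewrite /cPr (eq_Pr (fun p => best_in_sub p AB BDA)).
rewrite (@order_event_exchangeable_indep _ A)//; last exact: best_in_order_event.
rewrite mulf_eq0 negb_or => /andP[_ F0].
have -> : Pr (fun p => E p && best_in B D p) =
    Pr (fun p => E p && best_in A D p) * Pr (best_in B A).
  rewrite -(@order_event_exchangeable_indep _ A)//.
    by apply: eq_Pr => p; rewrite (best_in_sub p AB BDA) andbA.
  by move=> p p' so; rewrite (oE _ _ so) (best_in_order_event _ so).
by rewrite -mulf_div divff// mulr1.
Qed.

Lemma Pr_mulg N (s : 'S_N) (E : pred 'S_N) : Pr (fun p => E (s * p)%g) = Pr E.
Proof. by rewrite !PrE [in RHS](reindex_inj (mulgI s)). Qed.

Lemma perm_two_values N (x y x' y' : 'I_N) :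
  x != y -> x' != y' -> exists s : 'S_N, s x = x' /\ s y = y'.
Proof.
move=> xy xy'; set z := tperm x x' y.
have zx' : z != x'.
  by rewrite -[X in _ != X](tpermL x x') (inj_eq perm_inj) eq_sym.
exists (tperm x x' * tperm z y')%g.
by rewrite !permM tpermL -/z tpermL tpermD// eq_sym.
Qed.

Lemma Pr_two_values N (x y u v : 'I_N) : x != y -> u != v ->
  Pr (fun p : 'S_N => (p x == u) && (p y == v)) = 1 / (N%:R * (N%:R - 1)).
Proof.
move=> xy uv.
have N1 : (1 < N)%N.
  case: N x y u v xy uv => [|[|n]] // x y; first by case: x.
  by rewrite !ord1.
pose Q (x y : 'I_N) := Pr (fun p : 'S_N => (p x == u) && (p y == v)).
have Q_const x' y' : y' != x' -> Q x' y' = Q x y.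
  rewrite eq_sym => xy'; have [s [sx sy]] := perm_two_values xy xy'.
  rewrite -[RHS](Pr_mulg s); by apply: eq_Pr => p; rewrite !permM sx sy.
have : \sum_(x' : 'I_N) \sum_(y' : 'I_N | y' != x') Q x' y' = 1.
  rewrite -(@PrT N xpredT)//.
  rewrite (@Pr_sum _ _ xpredT _ (fun x' p => p x' == u)); last first.
    move=> p.
    rewrite (@sum_nat_bool1 _ xpredT (fun i => p i == u) ((p^-1)%g u)).
      by rewrite permKV eqxx.
    by move=> i /eqP<-; rewrite permK.
  apply: eq_bigr => x' _; apply/esym/Pr_sum => p.
  rewrite (@sum_nat_bool1 _ _ (fun i => (p x' == u) && (p i == v))
             ((p^-1)%g v)).
    rewrite permKV eqxx andbT; have [pxu|] := eqVneq (p x') u.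
      by rewrite -(inj_eq (@perm_inj _ p)) permKV pxu eq_sym uv.
    by rewrite andbF.
  by move=> i /andP[_ /eqP<-]; rewrite permK.
rewrite (eq_bigr (fun=> Q x y *+ N.-1)); last first.
  move=> x' _; rewrite (eq_bigr (fun=> Q x y)); last by move=> y'; exact: Q_const.
  by rewrite (sumr_const (predC1 x')) cardC1 card_ord.
rewrite sumr_const card_ord -mulrnA -[_ *+ _]mulr_natr natrM.
rewrite -subn1 natrB; last exact: ltnW.
move=> Q1; have nz : N%:R * (N%:R - 1) != 0 :> rat.
  rewrite mulf_neq0 ?subr_eq0 ?(eqr_nat _ N 1) ?pnatr_eq0 -?lt0n ?(ltnW N1)//.
  by rewrite neq_ltn N1 orbT.
by apply: (mulIf nz); rewrite divfK// [N%:R * _]mulrC; exact: Q1.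
Qed.

Lemma big_irange N (b a : nat) (G : int -> rat) : (a <= N)%N ->
  \sum_(i <- irange (b%:Z + 1) a%:Z) G i =
  \sum_(w : 'I_N | b%:Z + 1 <= idx w <= a%:Z) G (idx w).
Proof.
move=> aN; rewrite /irange; case: ifPn => [ab|].
  by rewrite big_nil big1// => w; rewrite /idx; lia.
rewrite -leNgt => ba.
have -> : `|a%:Z - (b%:Z + 1)%R|%N.+1 = (a - b)%N by lia.
rewrite big_map -{1}[(a - b)%N]subn0 -/(index_iota 0 (a - b)).
transitivity (\sum_(b <= k < a) G k.+1%:Z).
  rewrite -{3}[b]add0n big_addn; apply: eq_big_nat => k _.
  by congr G; lia.
rewrite (@big_nat_widenl _ _ _ _ 0%N)// (@big_nat_widen _ _ _ _ _ N)// big_mkord.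
by apply: eq_bigl => w; rewrite /idx; lia.
Qed.

Lemma ceil_divP (x : int) (K : nat) : (0 < K)%N ->
  (ceil_div x K - 1) * K%:Z < x <= ceil_div x K * K%:Z.
Proof.
move=> K0; have K0' : 0 < K%:R :> rat by rewrite ltr0n.
have := ceil_itv (x%:~R / K%:R : rat).
rewrite -/(ceil_div x K) ltr_pdivlMr// ler_pdivrMr//.
by rewrite -[K%:R]/(K%:Z%:~R) -!intrM ltr_int ler_int.
Qed.

Lemma sum_chunks (I : finType) (pos : I -> int) (phi : I -> rat) (D : int)
    (K : nat) (M : int) :
  \sum_(r <- irange (-1) M)
    (if r <= 0 then 0
     else \sum_(w | D + (r - 1) * K%:Z + 1 <= pos w <= D + r * K%:Z) phi w) =
  \sum_(w | D + 1 <= pos w <= D + M * K%:Z) phi w.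
Proof.
rewrite /irange; case: ifPn => [M1|].
  by rewrite big_nil big_pred0// => w; apply/negP; nia.
rewrite -leNgt => M1; rewrite big_map.
have -> : M = -1 + `|(M - -1)%R|%N%:Z by lia.
move: `|(M - -1)%R|%N => m; have -> : `|(-1 + m%:Z - -1)%R|%N = m by lia.
elim: m => [|m IHm].
  by rewrite /= big_seq1 /= big_pred0// => w; apply/negP; nia.
rewrite -addn1 iotaD big_cat /= big_seq1 add0n IHm {IHm}.
case: ifPn => r0.
  have -> : m = 0%N by lia.
  by rewrite addr0 !big_pred0// => w; apply/negP; nia.
rewrite [RHS](bigID (fun w => pos w <= D + (-1 + m%:Z) * K%:Z)) /=.
congr (_ + _); apply: eq_bigl => w; nia.
Qed.

Lemma sum_chunks_last (I : finType) (pos : I -> int) (phi : I -> rat) (D i : int)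
    (K : nat) : (0 < K)%N ->
  let n := ceil_div (i - D) K in
  \sum_(r <- irange (-1) (n - 2))
    (if r <= 0 then 0
     else \sum_(w | D + (r - 1) * K%:Z + 1 <= pos w <= D + r * K%:Z) phi w)
  + (if n - 1 <= 0 then 0
     else \sum_(w | D + (n - 1 - 1) * K%:Z + 1 <= pos w <= i - K%:Z) phi w) =
  \sum_(w | D + 1 <= pos w <= i - K%:Z) phi w.
Proof.
move=> K0 n; have := ceil_divP (i - D) K0; rewrite -/n => nP.
rewrite sum_chunks; case: ifPn => n0.
  by rewrite addr0 !big_pred0// => w; apply/negP; nia.
rewrite [RHS](bigID (fun w => pos w <= D + (n - 2) * K%:Z)) /=.
congr (_ + _); apply: eq_bigl => w; nia.
Qed.

Lemma in_seen N K x (i : 'I_N) : (i \in seen N K x) = (idx i <= x + K%:Z - 1).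
Proof. by rewrite inE. Qed.

Lemma seen_sub N K (x y : int) : x <= y -> seen N K x \subset seen N K y.
Proof. by move=> xy; apply/subsetP=> i; rewrite !in_seen; lia. Qed.

Lemma window_seen N K x (i : 'I_N) : i \in window N K x -> i \in seen N K x.
Proof. by rewrite !inE => /andP[]. Qed.

Lemma idx_inj N : injective (@idx N).
Proof. by move=> i j; rewrite /idx => -[] ij; apply: val_inj. Qed.

Lemma best_seen_byE N K d x (p : 'S_N) :
  best_seen_by K d x p = best_in (seen N K x) [set i | idx i <= d%:Z] p.
Proof.
rewrite /best_seen_by; move: (seen N K x) => A.
apply/exists_inP/best_inP => [[i iA /andP[/eqP[] /eqP]]|[i [iA]]].
  rewrite cards_eq0 => /eqP no_better id; exists i; split; rewrite ?inE// => j jA.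
  have := in_set0 j; rewrite -no_better inE jA /rank ltnS /=.
  by move=> /negbT; rewrite -leqNgt.
rewrite inE => id im; exists i => //; rewrite id andbT eqSS cards_eq0.
apply/eqP/setP=> j; rewrite !inE; apply/negP=> /andP[jA].
by rewrite /rank ltnS ltnNge im.
Qed.

Lemma rank_among_order N (A : {set 'I_N}) (p p' : 'S_N) i :
  same_order A p p' -> i \in A -> rank_among p A i = rank_among p' A i.
Proof.
move=> /same_orderP so iA; rewrite /rank_among; congr _.+1.
apply: eq_card => j; rewrite !inE; case jA: (j \in A) => //=.
by rewrite /rank !ltnS so.
Qed.

Lemma rank_among_le N (A : {set 'I_N}) (p : 'S_N) i :
  (rank_among p A i <= rank p i)%N.
Proof.
rewrite ltnS cardE -(size_map (fun j => p j : nat)) -[leqRHS](size_iota 0).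
apply: uniq_leq_size.
  by rewrite map_inj_uniq ?enum_uniq// => j k /val_inj/perm_inj.
move=> _ /mapP[j + ->]; rewrite mem_enum inE => /andP[_].
by rewrite mem_iota /rank ltnS.
Qed.

Lemma candidate_order N K x (p p' : 'S_N) i :
  same_order (seen N K x) p p' -> candidate K p x i = candidate K p' x i.
Proof.
move=> /same_orderP so; rewrite /candidate /cPr.
have so_eq : same_order (seen N K x) p =1 same_order (seen N K x) p'.
  by move=> r; apply/same_orderP/same_orderP => ro j k jA kA; rewrite -ro// so.
rewrite (eq_Pr so_eq); congr (_ && (0 < _ / _)).
by apply: eq_Pr => r; rewrite so_eq.
Qed.

Lemma r_candidate_order N K r x (p p' : 'S_N) i :
  same_order (seen N K x) p p' -> r_candidate K r p x i = r_candidate K r p' x i.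
Proof.
move=> so; rewrite /r_candidate (candidate_order _ so).
case ci: (candidate K p' x i) => //=.
by rewrite (rank_among_order so)//; case/andP: ci => /window_seen.
Qed.

Lemma sliding_rule_order_event N K w :
  order_event (seen N K (idx w)) (fun p => sliding_rule K p w).
Proof.
move=> p p' so; rewrite /sliding_rule (candidate_order _ so).
case cw: (candidate K p' (idx w) w) => //=.
apply: eq_forallb => i; rewrite (candidate_order _ so).
case ci: (candidate K p' (idx w) i) => //=.
case/andP: cw => /window_seen ws _; case/andP: ci => /window_seen is_ _.
rewrite ![(rank _ w <= _)%N]leqNgt /rank !ltnS.
by rewrite (same_orderP _ _ _ so).
Qed.

Lemma accepts_order_event N K d1 d2 w :
  order_event (seen N K (idx w)) (fun p => accepts K d1 d2 p w).
Proof.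
move=> p p' so; rewrite /accepts (sliding_rule_order_event so).
by rewrite !(r_candidate_order _ _ so).
Qed.

Lemma stops_at_order_event N K d1 d2 w :
  order_event (seen N K (idx w)) (fun p => stops_at K d1 d2 p w).
Proof.
move=> p p' so; rewrite /stops_at (accepts_order_event _ _ so); congr (_ && _).
apply: eq_forallb => v; case vw: (idx v < idx w) => //=; congr (~~ _).
by apply: accepts_order_event; apply: same_order_sub so; apply/seen_sub/ltW.
Qed.

Definition stops_at_r N K d1 d2 r (w : 'I_N) (p : 'S_N) :=
  stops_at K d1 d2 p w && r_candidate K r p (idx w) w.

Lemma stops_at_r_order_event N K d1 d2 r w :
  order_event (seen N K (idx w)) (@stops_at_r N K d1 d2 r w).
Proof.
move=> p p' so.
by rewrite /stops_at_r (stops_at_order_event _ _ so) (r_candidate_order _ _ so).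
Qed.

Lemma stops_at_uniq N K d1 d2 (p : 'S_N) v w :
  stops_at K d1 d2 p v -> stops_at K d1 d2 p w -> v = w.
Proof.
move=> /andP[av /forallP fv] /andP[aw /forallP fw]; apply: idx_inj.
have := fv w; have := fw v; rewrite av aw !implybF; lia.
Qed.

Lemma stops_at_r_sum N K d1 d2 r lo hi (p : 'S_N) :
  stops_at_r_candidate K d1 d2 r lo hi p =
  (\sum_(w : 'I_N | (lo <= idx w <= hi)%R) stops_at_r K d1 d2 r w p)%N :> nat.
Proof.
have [/existsP[w /and3P[sw cw wb]]|no] := boolP (stops_at_r_candidate _ _ _ _ _ _ _).
  rewrite (@sum_nat_bool1 _ _ (fun w => stops_at_r K d1 d2 r w p) w).
    by rewrite wb /stops_at_r sw cw.
  by move=> v /andP[sv _]; apply: stops_at_uniq sv sw.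
rewrite big1// => w wb; case sw: (stops_at_r _ _ _ _ _ _) => //.
case/negP: no; apply/existsP; exists w.
by case/andP: sw => -> ->.
Qed.

Lemma Pr_stops_at_r N K d1 d2 r lo hi :
  Pr (@stops_at_r_candidate N K d1 d2 r lo hi) =
  \sum_(w | lo <= idx w <= hi) Pr (@stops_at_r N K d1 d2 r w).
Proof. by apply: Pr_sum => p; exact: stops_at_r_sum. Qed.

Lemma cPr_stops_at_r N K d1 d2 r lo hi (F : pred 'S_N) :
  cPr (@stops_at_r_candidate N K d1 d2 r lo hi) F =
  \sum_(w | lo <= idx w <= hi) cPr (@stops_at_r N K d1 d2 r w) F.
Proof.
rewrite -mulr_suml; congr (_ / _); apply: Pr_sum => p.
case: (F p); first by under eq_bigr do rewrite andbT; rewrite andbT stops_at_r_sum.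
by rewrite andbF big1// => w _; rewrite andbF.
Qed.

Lemma Pr_best_seen_by_neq0 N K d x (w : 'I_N) :
  (0 < d)%N -> w \in seen N K x -> Pr (@best_seen_by N K d x) != 0.
Proof.
move=> d0 wA; rewrite gt_eqF//; apply: (@Pr_gt0 _ _ 1%g).
case: N w wA => [[]//|n] w; rewrite in_seen /idx => wA.
rewrite best_seen_byE; apply/best_inP; exists ord0; split.
- by rewrite in_seen /idx /=; lia.
- by rewrite inE /idx /=; lia.
by move=> j _; rewrite !perm1.
Qed.

Lemma cPr_stops_best_seen_by N K d1 d2 d x w :
  (0 < d)%N -> (d%:Z < idx w) -> (0 < K)%N -> idx w <= x ->
  cPr (@stops_at_r N K d1 d2 2 w) (best_seen_by K d x) =
  cPr (@stops_at_r N K d1 d2 2 w) (best_seen_by K d (idx w)).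
Proof.
move=> d0 dw K0 wx.
have eqc y : cPr (@stops_at_r N K d1 d2 2 w) (best_seen_by K d y) =
    cPr (@stops_at_r N K d1 d2 2 w) (best_in (seen N K y) [set i | idx i <= d%:Z]).
  by rewrite /cPr; congr (_ / _); apply: eq_Pr => p; rewrite best_seen_byE.
rewrite !eqc; apply: cPr_best_in_sub.
- exact: seen_sub.
- by apply/subsetP=> i; rewrite !inE => /andP[]; lia.
- exact: stops_at_r_order_event.
rewrite -(eq_Pr (best_seen_byE K d x)).
by apply: (@Pr_best_seen_by_neq0 _ _ _ _ w) => //; rewrite in_seen; lia.
Qed.

Lemma h_sum N K d1 d2 s a : (0 < d1)%N -> (d1 <= d2)%N -> (0 < K)%N ->
  h N K d1 d2 s a =
  if s <= 0 then 0 else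
  \sum_(w : 'I_N | d2%:Z + (s - 1) * K%:Z + 1 <= idx w <= a)
    cPr (@stops_at_r N K d1 d2 2 w) (best_seen_by K d1 (idx w)).
Proof.
move=> d0 d12 K0; rewrite /h; case: ifP => // s0.
rewrite cPr_stops_at_r; apply: eq_bigr => w /andP[lw wa].
apply: cPr_stops_best_seen_by => //; nia.
Qed.

Lemma cE N K d1 d2 (i : int) : (0 < d1)%N -> (d1 <= d2)%N -> (0 < K)%N ->
  c N K d1 d2 i =
  cPr (@stops_at_r_candidate N K d1 d2 2 (d2%:Z + 1) (i - K%:Z))
      (best_seen_by K d1 (i - K%:Z)).
Proof.
move=> d0 d12 K0; rewrite /c cPr_stops_at_r.
under eq_bigr do rewrite h_sum//.
rewrite h_sum// sum_chunks_last//.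
apply: eq_bigr => w /andP[lw wa]; apply/esym/cPr_stops_best_seen_by => //; lia.
Qed.

Lemma tE N K d1 d2 (i : int) : (0 < K)%N ->
  t N K d1 d2 i =
  Pr (@stops_at_r_candidate N K d1 d2 1 (d1%:Z + 1) (i - K%:Z)) +
  Pr (@stops_at_r_candidate N K d1 d2 2 (d2%:Z + 1) (i - K%:Z)).
Proof.
move=> K0; rewrite /t -addrA; congr (_ + _).
  under eq_bigr do rewrite /f Pr_stops_at_r.
  by rewrite /f !Pr_stops_at_r sum_chunks_last.
under eq_bigr do rewrite /g Pr_stops_at_r.
by rewrite /g !Pr_stops_at_r sum_chunks_last.
Qed.

Lemma top_two_candidate N K x (p : 'S_N) i :
  top_two p i -> i \in window N K x -> candidate K p x i.
Proof.
move=> pi iw; rewrite /candidate iw /=.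
apply: divr_gt0; apply: (@Pr_gt0 _ _ p); rewrite ?pi /=; exact: same_order_refl.
Qed.

Lemma accepts_window_best N K d1 d2 (p : 'S_N) v i :
  accepts K d1 d2 p v -> i \in window N K (idx v) -> top_two p i ->
  (rank p v <= rank p i)%N.
Proof.
move=> /andP[/andP[_ /forallP/(_ i)/implyP best] _] iw pi.
exact/best/top_two_candidate.
Qed.

Lemma accepts_cases N K d1 d2 (p : 'S_N) v :
  (d1 <= d2)%N -> accepts K d1 d2 p v ->
  d1%:Z < idx v /\ r_candidate K 1 p (idx v) v \/
  d2%:Z < idx v /\ r_candidate K 2 p (idx v) v.
Proof.
move=> d12 /andP[_ /orP[/andP[]|/andP[dv /orP[]]]]; [by left| |by right].
by left; split=> //; apply: le_lt_trans dv; rewrite lez_nat.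
Qed.

Lemma r_candidate1_best N K x (p : 'S_N) v j :
  r_candidate K 1 p x v -> j \in seen N K x -> (rank p v <= rank p j)%N.
Proof.
move=> /andP[_]; rewrite eqSS cards_eq0 => /eqP no_better jA.
rewrite leqNgt; apply/negP => jv.
by have := in_set0 j; rewrite -no_better inE jA jv.
Qed.

Lemma accepts_top_two N K d1 d2 (p : 'S_N) w :
  (0 < K)%N -> top_two p w ->
  {in window N K (idx w), forall k, (rank p w <= rank p k)%N} ->
  (d2%:Z < idx w \/ d1%:Z < idx w /\
     {in seen N K (idx w), forall k, (rank p w <= rank p k)%N}) ->
  accepts K d1 d2 p w.
Proof.
move=> K0 pw best late.
have ww : w \in window N K (idx w) by rewrite inE; lia.
have cw := top_two_candidate pw ww.
rewrite /accepts /sliding_rule cw /=; apply/andP; split.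
  by apply/forallP => i; apply/implyP=> /andP[/best].
rewrite /r_candidate cw /=.
case: late => [d2w|[d1w bestw]].
  rewrite d2w /=; apply/orP; right.
  have := leq_trans (rank_among_le (seen N K (idx w)) p w) pw.
  by rewrite /rank_among; case: (#|_|) => [|[|]].
rewrite d1w /= eqSS cards_eq0; apply/orP; left.
apply/eqP/setP => k; rewrite [RHS]inE; apply/negP; rewrite inE => /andP[ks].
by rewrite ltnNge bestw.
Qed.

Lemma first_accepted N K d1 d2 (p : 'S_N) e :
  accepts K d1 d2 p e -> exists2 w, stops_at K d1 d2 p w & idx w <= idx e.
Proof.
move=> ae; pose w := [arg min_(w < e | accepts K d1 d2 p w) w]%N.
have [aw wmin] : accepts K d1 d2 p w /\
    forall v, accepts K d1 d2 p v -> (w <= v)%N.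
  by rewrite /w; case: arg_minnP.
exists w; last by rewrite /idx lez_nat ltnS wmin.
rewrite /stops_at aw; apply/forallP=> v; apply/implyP=> vw; apply/negP=> /wmin.
by move: vw; rewrite /idx; lia.
Qed.

Lemma stops_at_top_two N K d1 d2 (p : 'S_N) i j :
  (0 < K)%N -> (d1 <= d2)%N -> idx j <= d1%:Z -> d2%:Z < idx i ->
  top_two p i -> top_two p j -> (forall k, top_two p k -> k = i \/ k = j) ->
  stops_at K d1 d2 p i =
  ~~ stops_at_r_candidate K d1 d2 2 (d2%:Z + 1) (idx i - K%:Z) p.
Proof.
move=> K0 d12 jd id pi pj ij.
have ai : accepts K d1 d2 p i.
  apply: accepts_top_two => //; last by left.
  move=> k; rewrite inE leqNgt => ki; apply/negP=> pki.
  have [] := ij k (leq_trans (ltnW pki) pi) => ek; subst k.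
    by rewrite ltnn in pki.
  by move: ki; lia.
apply/idP/idP => [si|/existsPn noS].
  apply/existsPn=> w; apply/negP=> /and3P[sw _ wb].
  by move: wb; rewrite (stops_at_uniq sw si); lia.
have [w sw wi] := first_accepted ai.
have [<- //|wni] := eqVneq w i.
have {}wi : idx w < idx i by rewrite lt_neqAle (inj_eq (@idx_inj N)) wni.
have aw : accepts K d1 d2 p w by case/andP: sw.
have [dw not_top] : d1%:Z < idx w /\ ~~ top_two p w.
  have dw : d1%:Z < idx w by case: (accepts_cases d12 aw) => -[]; lia.
  split=> //; apply/negP=> /ij[] ew; first by rewrite ew eqxx in wni.
  by subst w; lia.
case: (accepts_cases d12 aw) => -[d1w cw].
  case/negP: not_top; apply: (leq_trans _ pj).
  by apply: (r_candidate1_best cw); rewrite in_seen; lia.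
have [wiK|wiK] := lerP (idx w) (idx i - K%:Z).
  have := noS w; rewrite sw cw wiK; lia.
case/negP: not_top; apply: (leq_trans _ pi).
by apply: (accepts_window_best aw) => //; rewrite inE; lia.
Qed.

Lemma wins_choosing_by_top_two N K d1 d2 (p : 'S_N) i j a :
  (d1 <= d2)%N -> idx j <= d1%:Z ->
  top_two p i -> (forall k, top_two p k -> k = i \/ k = j) ->
  wins_choosing_by K d1 d2 a p = stops_at K d1 d2 p i && (idx i <= a).
Proof.
move=> d12 jd pi ij; apply/existsP/andP => [[w /and3P[sw pw /andP[_ wa]]]|[si ia]].
  case: (ij w pw) => ew; subst w => //.
  have aw : accepts K d1 d2 p j by case/andP: sw.
  by case: (accepts_cases d12 aw) => -[]; lia.
by exists i; rewrite si pi ia /idx.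
Qed.

Definition stops_by N K d1 d2 (x : int) (p : 'S_N) :=
  stops_at_r_candidate K d1 d2 1 (d1%:Z + 1) x p
  || stops_at_r_candidate K d1 d2 2 (d2%:Z + 1) x p.

Lemma stops_byP N K d1 d2 x (p : 'S_N) : (d1 <= d2)%N ->
  reflect (exists2 w, stops_at K d1 d2 p w & idx w <= x) (stops_by K d1 d2 x p).
Proof.
move=> d12; apply: (iffP orP) => [[]/existsP[w /and3P[sw _ /andP[_ wx]]]|[w sw wx]].
- by exists w.
- by exists w.
have aw : accepts K d1 d2 p w by case/andP: sw.
case: (accepts_cases d12 aw) => -[dw cw]; [left|right]; apply/existsP; exists w;
  by rewrite sw cw wx; lia.
Qed.

Lemma wins_top_two N K d1 d2 (p : 'S_N) i j :
  (0 < K)%N -> (d1 <= d2)%N -> d1%:Z < idx i -> idx i < idx j ->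
  top_two p i -> top_two p j -> (forall k, top_two p k -> k = i \/ k = j) ->
  wins K d1 d2 p = ~~ stops_by K d1 d2 (idx i - K%:Z) p.
Proof.
move=> K0 d12 di ltij pi pj ij.
apply/existsP/idP => [[w /andP[sw pw]]|/(stops_byP _ _ _ d12) noS].
  apply/(stops_byP _ _ _ d12) => -[v sv]; rewrite (stops_at_uniq sv sw).
  by case: (ij w pw) => ->; lia.
have best k l : top_two p k ->
    (forall m, top_two p m -> m != k -> ~~ (rank p m < rank p k)%N) ->
    (rank p k <= rank p l)%N.
  move=> pk km; rewrite leqNgt; apply/negP=> lk.
  have := km l (leq_trans (ltnW lk) pk); rewrite lk /=.
  by case: eqVneq lk => [->|_ _ /(_ isT)//]; rewrite ltnn.
have [e [ae pe ej]] : exists e, [/\ accepts K d1 d2 p e, top_two p e &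
    e = j -> j \in window N K (idx i)].
  have [ltp|lep] := ltnP (rank p i) (rank p j).
    exists i; split=> //; last by move=> eij; move: ltij; rewrite eij ltxx.
    have bi l : (rank p i <= rank p l)%N.
      by apply: best => // m /ij[] -> //; rewrite ?eqxx// -leqNgt ltnW.
    by apply: accepts_top_two => //; right; split=> // k _; exact: bi.
  have [jw|jw] := boolP (j \in window N K (idx i)).
    exists j; split=> //.
    have bj l : (rank p j <= rank p l)%N.
      by apply: best => // m /ij[] -> //; rewrite ?eqxx// -leqNgt.
    apply: accepts_top_two => //; right.
    by split=> [|k _]; [lia | exact: bj].
  exists i; split=> //; last by move=> eij; move: ltij; rewrite eij ltxx.
  have bi l : l \in seen N K (idx i) -> (rank p i <= rank p l)%N.
    move=> ls; rewrite leqNgt; apply/negP => li.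
    have [] := ij l (leq_trans (ltnW li) pi) => el; subst l.
      by rewrite ltnn in li.
    by case/negP: jw; move: ls; rewrite !inE; lia.
  apply: accepts_top_two => //; last by right.
  by move=> k /window_seen; exact: bi.
have [w sw we] := first_accepted ae; exists w; rewrite sw /=.
have aw : accepts K d1 d2 p w by case/andP: sw.
have wK : idx i - K%:Z < idx w.
  by rewrite ltNge; apply/negP=> wK; apply: noS; exists w.
have [wi|iw] := lerP (idx w) (idx i).
  apply: (leq_trans _ pi); apply: (accepts_window_best aw) => //.
  by rewrite inE; lia.
case: (ij e pe) => ee; first by move: we; rewrite ee; lia.
have := ej ee; rewrite inE => jw; rewrite ee in we.
apply: (leq_trans _ pj); apply: (accepts_window_best aw) => //.
by rewrite inE; lia.
Qed.

Lemma sum_const_idx_le N d (x : rat) :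
  (d <= N)%N -> \sum_(j : 'I_N | idx j <= d%:Z) x = d%:R * x.
Proof.
move=> dN; rewrite mulr_natl.
transitivity (\sum_(j < N | (j < d)%N) x); first exact: eq_bigl.
by rewrite -(big_ord_widen _ (fun=> x) dN) sumr_const card_ord.
Qed.

Lemma sum_const_idx_gt N d (x : rat) :
  (d <= N)%N -> \sum_(j : 'I_N | d%:Z < idx j) x = (N%:R - d%:R) * x.
Proof.
move=> dN; rewrite mulrBl -(sum_const_idx_le x dN).
rewrite -[N in N%:R * x]card_ord mulr_natl -sumr_const.
rewrite [X in _ = X - _](bigID (fun j : 'I_N => idx j <= d%:Z)) /= addrAC subrr add0r.
by apply: eq_bigl => j; rewrite ltNge.
Qed.

Lemma stops_at_r_candidate_order_event N K d1 d2 r lo hi :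
  order_event (seen N K hi) (@stops_at_r_candidate N K d1 d2 r lo hi).
Proof.
move=> p p' so; apply: eq_existsb => w.
case wh: (idx w <= hi); last by rewrite !andbF.
have so' : same_order (seen N K (idx w)) p p'.
  by apply: same_order_sub so; apply: seen_sub.
by rewrite (stops_at_order_event _ _ so') (r_candidate_order _ _ so').
Qed.

Lemma Pr_stops_by N K d1 d2 x :
  Pr (@stops_by N K d1 d2 x) =
  Pr (@stops_at_r_candidate N K d1 d2 1 (d1%:Z + 1) x)
  + Pr (@stops_at_r_candidate N K d1 d2 2 (d2%:Z + 1) x).
Proof.
apply: PrD => p; rewrite /stops_by.
case S1: (stops_at_r_candidate _ _ _ 1 _ _ _) => //=.
case S2: (stops_at_r_candidate _ _ _ 2 _ _ _) => //=.
move/existsP: S1 => [w /and3P[sw /andP[_ cw] _]].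
move/existsP: S2 => [v /and3P[sv /andP[_ cv] _]].
by rewrite (stops_at_uniq sv sw) (eqP cw) in cv.
Qed.

(* {u, v} = {0, 1} in either order, so that one lemma serves both sigma1
   (u = 0, v = 1) and sigma2 (u = 1, v = 0). *)
Definition top_two_values N (u v : 'I_N) :=
  u != v /\ forall z : 'I_N, (z < 2)%N = (z == u) || (z == v).

Lemma top_two_valuesP N (u v : 'I_N) (p : 'S_N) i : top_two_values u v ->
  top_two p i = (i == (p^-1)%g u) || (i == (p^-1)%g v).
Proof.
move=> [_ uv]; rewrite /top_two /rank ltnS -[(p i <= 1)%N]/(p i < 2)%N uv.
by rewrite -{1}(permKV p u) -{1}(permKV p v) !(inj_eq (@perm_inj _ p)).
Qed.

Definition wins_after N K d1 d2 (u v : 'I_N) (i : 'I_N) (p : 'S_N) :=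
  [&& p i == v, idx ((p^-1)%g u) <= d1%:Z &
     ~~ stops_at_r_candidate K d1 d2 2 (d2%:Z + 1) (idx i - K%:Z) p].

Lemma Pr_wins_after N K d1 d2 (u v i : 'I_N) :
  (0 < K)%N -> (d1 <= d2)%N -> top_two_values u v -> d2%:Z < idx i ->
  Pr (wins_after K d1 d2 u v i) =
  d1%:R / N%:R * (1 / (N%:R - 1)) * (1 - c N K d1 d2 (idx i)).
Proof.
move=> K0 d12 uv di.
have [d10|d10] := posnP d1.
  rewrite d10 !mul0r; apply: Pr_eq0 => p; apply/negP => /and3P[_].
  by rewrite /idx; lia.
have d1N : (d1 <= N)%N by have := ltn_ord i; move: di; rewrite /idx; lia.
pose A := seen N K (idx i - K%:Z).
pose B := @best_seen_by N K d1 (idx i - K%:Z).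
pose S := @stops_at_r_candidate N K d1 d2 2 (d2%:Z + 1) (idx i - K%:Z).
pose F (p : 'S_N) := (p i == v) && [exists j in A, p j == u].
have iA : i \notin A by rewrite in_seen; lia.
have oB : order_event A B.
  by move=> p p' so; rewrite /B !best_seen_byE; apply: best_in_order_event.
have oS : order_event A S by exact: stops_at_r_candidate_order_event.
have xF : exchangeable A F.
  apply: exchangeable_of_imp => s p sA /andP[].
  rewrite permM (out_perm sA iA) => pi /exists_inP[j jA]; rewrite permM => pj.
  by rewrite /F pi; apply/exists_inP; exists (s j) => //; rewrite perm_closed.
have BF p : B p && F p = (p i == v) && (idx ((p^-1)%g u) <= d1%:Z).
  apply/idP/idP => [/and3P[Bp pi /exists_inP[j jA /eqP pj]]|/andP[/eqP pi jd]].
    rewrite pi /=; move: Bp; rewrite /B best_seen_byE => /best_inP[k [kA kd km]].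
    have : top_two p k.
      apply: leq_ltn_trans (km j jA) _.
      by case: uv => _ ->; rewrite pj eqxx.
    rewrite (top_two_valuesP _ _ uv) -(eqP pi) permK => /orP[] /eqP ek.
      by move: kd; rewrite inE ek.
    by rewrite ek (negbTE iA) in kA.
  have jA : (p^-1)%g u \in A by rewrite in_seen; lia.
  rewrite /F pi eqxx /=; apply/andP; split.
    rewrite /B best_seen_byE; apply/best_inP; exists ((p^-1)%g u).
    split=> [//||k kA]; first by rewrite inE.
    rewrite leqNgt; apply/negP => kj.
    have : top_two p k.
      apply: ltn_trans kj _; rewrite permKV.
      by case: uv => _ ->; rewrite eqxx.
    rewrite (top_two_valuesP _ _ uv) -pi permK => /orP[] /eqP ek.
      by rewrite ek ltnn in kj.
    by rewrite ek (negbTE iA) in kA.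
  by apply/exists_inP; exists ((p^-1)%g u) => //; rewrite permKV.
have PBF : Pr B * Pr F = d1%:R / N%:R * (1 / (N%:R - 1)).
  rewrite -(order_event_exchangeable_indep oB xF) (eq_Pr BF).
  rewrite (@Pr_sum _ _ (fun j => idx j <= d1%:Z) _
             (fun j p => (p j == u) && (p i == v))); last first.
    move=> p; rewrite (@sum_nat_bool1 _ _ (fun j => (p j == u) && (p i == v))
                         ((p^-1)%g u)).
      by rewrite permKV eqxx /= andbC.
    by move=> j /andP[/eqP<- _]; rewrite permK.
  under eq_bigr => j jd.
    rewrite Pr_two_values; [over| |by case: uv].
    by apply/eqP=> ji; move: jd di; rewrite ji; lia.
  by rewrite sum_const_idx_le// invfM; ring.
have PB0 : Pr B != 0.
  have N0 := leq_ltn_trans (leq0n i) (ltn_ord i).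
  apply: (@Pr_best_seen_by_neq0 _ _ _ _ (Ordinal N0)) => //.
  by rewrite in_seen {1}/idx /=; lia.
have -> : Pr (wins_after K d1 d2 u v i) =
    Pr (fun p => (B p && ~~ S p) && F p).
  by apply: eq_Pr => p; rewrite /wins_after andbA -BF andbAC.
rewrite (order_event_exchangeable_indep _ xF); last first.
  by move=> p p' so; rewrite (oB _ _ so) (oS _ _ so).
rewrite -PBF cE// /cPr -/B -/S.
have PB : Pr B = Pr (fun p => S p && B p) + Pr (fun p => B p && ~~ S p).
  by apply: PrD => p; case: (B p); case: (S p).
have -> : Pr (fun p => B p && ~~ S p) = Pr B - Pr (fun p => S p && B p).
  by rewrite PB addrAC subrr add0r.
by field.
Qed.

Lemma Pr_wins_choosing_by_step N K d1 d2 (u v : 'I_N) (e a b : nat) :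
  (0 < K)%N -> (d1 <= d2)%N -> top_two_values u v ->
  (e <= d2)%N -> (d2 <= b)%N -> (b <= a)%N -> (a <= N)%N ->
  let W x (p : 'S_N) := (idx ((p^-1)%g u) <= d1%:Z) && (e%:Z < idx ((p^-1)%g v))
                && wins_choosing_by K d1 d2 x p in
  Pr (W a%:Z) = Pr (W b%:Z) + \sum_(i <- irange (b%:Z + 1) a%:Z)
           d1%:R / N%:R * (1 / (N%:R - 1)) * (1 - c N K d1 d2 i).
Proof.
move=> K0 d12 uv ed db ba aN W; rewrite (big_irange _ _ aN).
have -> : \sum_(i : 'I_N | b%:Z + 1 <= idx i <= a%:Z)
     d1%:R / N%:R * (1 / (N%:R - 1)) * (1 - c N K d1 d2 (idx i)) =
   \sum_(i | b%:Z + 1 <= idx i <= a%:Z) Pr (wins_after K d1 d2 u v i).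
  by apply: eq_bigr => i bia; rewrite Pr_wins_after//; lia.
pose V (p : 'S_N) := (b%:Z + 1 <= idx ((p^-1)%g v) <= a%:Z)
                     && wins_after K d1 d2 u v ((p^-1)%g v) p.
rewrite -(@Pr_sum _ _ _ V); last first.
  move=> p; rewrite (@sum_nat_bool1 _ _ (fun i => wins_after K d1 d2 u v i p)
                       ((p^-1)%g v))//.
  by move=> i /and3P[/eqP<- _]; rewrite permK.
apply: PrD => p; rewrite /W /V /wins_after permKV eqxx /=.
set i := (p^-1)%g v; set j := (p^-1)%g u.
have [jd|jd] := lerP (idx j) d1%:Z; last by rewrite !andbF.
have pi : top_two p i by rewrite (top_two_valuesP _ _ uv) eqxx orbT.
have pj : top_two p j by rewrite (top_two_valuesP _ _ uv) eqxx.
have ij k : top_two p k -> k = i \/ k = j.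
  by rewrite (top_two_valuesP _ _ uv) => /orP[] /eqP; [right|left].
rewrite !(wins_choosing_by_top_two _ _ d12 jd pi ij) /=.
have [id|id] := lerP (idx i) d2%:Z.
  have -> : (b%:Z + 1 <= idx i) = false by lia.
  have -> : idx i <= a%:Z by lia.
  have -> : idx i <= b%:Z by lia.
  by rewrite addn0.
rewrite (stops_at_top_two K0 d12 jd id pi pj ij).
have -> : e%:Z < idx i by lia.
case: (stops_at_r_candidate _ _ _ _ _ _ _) => /=; rewrite ?andbF//= ?andbT.
by case: (lerP (idx i) a%:Z); case: (lerP (idx i) b%:Z);
  case: (lerP (b%:Z + 1) (idx i)) => //=; lia.
Qed.

Definition wins_from N K d1 d2 (i : 'I_N) (p : 'S_N) :=
  [&& top_two p i, [forall j in seen N K (idx i - K%:Z), ~~ top_two p j] &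
      ~~ stops_by K d1 d2 (idx i - K%:Z) p].

Lemma Pr_wins_from N K d1 d2 (u v i : 'I_N) :
  (0 < K)%N -> top_two_values u v ->
  Pr (wins_from K d1 d2 i) =
  2 * ((N%:R - (idx i)%:~R) / (N%:R * (N%:R - 1))) * (1 - t N K d1 d2 (idx i)).
Proof.
move=> K0 uv.
pose A := seen N K (idx i - K%:Z).
pose T := @stops_by N K d1 d2 (idx i - K%:Z).
pose F (p : 'S_N) := top_two p i && [forall j in A, ~~ top_two p j].
have iA j : (j \in A) = (idx j < idx i) by rewrite in_seen; lia.
have oT : order_event A (fun p => ~~ T p).
  move=> p p' so; congr (~~ (_ || _)); exact: stops_at_r_candidate_order_event so.
have xF : exchangeable A F.
  apply: exchangeable_of_imp => s p sA /andP[].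
  have -> : top_two (s * p)%g i = top_two p i.
    by rewrite /top_two /rank permM (out_perm sA)// iA ltxx.
  rewrite /F => -> /forall_inP none; apply/forall_inP => j jA.
  have := none ((s^-1)%g j); rewrite /top_two /rank permM permKV; apply.
  by rewrite perm_closed// perm_onV.
have PF : Pr F = 2 * ((N%:R - (idx i)%:~R) / (N%:R * (N%:R - 1))).
  pose G (x y : 'I_N) (p : 'S_N) := (p i == x) && (idx i < idx ((p^-1)%g y)).
  have PG x y : x != y ->
      Pr (G x y) = (N%:R - (idx i)%:~R) / (N%:R * (N%:R - 1)).
    move=> xy.
    rewrite (@Pr_sum _ _ (fun j => (i.+1)%:Z < idx j) _
               (fun j p => (p i == x) && (p j == y))); last first.
      move=> p.
      rewrite (@sum_nat_bool1 _ _ (fun j => (p i == x) && (p j == y))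
                 ((p^-1)%g y)).
        by rewrite permKV eqxx andbT andbC.
      by move=> j /andP[_ /eqP<-]; rewrite permK.
    under eq_bigr => j ji.
      rewrite Pr_two_values; [over| |done].
      by apply/eqP=> ij; move: ji; rewrite -ij /idx; lia.
    by rewrite sum_const_idx_gt// mul1r.
  have := uv => -[uv1 _].
  rewrite (@PrD _ _ (G u v) (G v u)); first by rewrite !PG// 1?eq_sym//; ring.
  move=> p; rewrite /F (top_two_valuesP _ _ uv) /G.
  have value_at z : (p i == z) = (i == (p^-1)%g z).
    by rewrite -[RHS](inj_eq (@perm_inj _ p)) permKV.
  rewrite !value_at; have : (p^-1)%g u != (p^-1)%g v by rewrite (inj_eq perm_inj).
  have -> : [forall j in A, ~~ top_two p j] =
      (idx i <= idx ((p^-1)%g u)) && (idx i <= idx ((p^-1)%g v)).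
    apply/forall_inP/andP => [none|[iu iv] j].
      by split; rewrite leNgt -iA; apply/negP => /none;
        rewrite (top_two_valuesP _ _ uv) eqxx ?orbT.
    rewrite iA (top_two_valuesP _ _ uv) => ji.
    by apply/negP => /orP[] /eqP ej; move: ji; rewrite ej; lia.
  move: ((p^-1)%g u) ((p^-1)%g v) => x y xy.
  have le_lt z : i != z -> (idx i <= idx z) = (idx i < idx z).
    by move=> iz; rewrite le_eqVlt (inj_eq (@idx_inj N)) (negbTE iz).
  have [ix|/le_lt->] := eqVneq i x; have [iy|/le_lt->] := eqVneq i y => //=.
  - by rewrite -ix iy eqxx in xy.
  - by rewrite ix lexx addn0.
  - by rewrite iy lexx andbT.
have -> : Pr (wins_from K d1 d2 i) = Pr (fun p => ~~ T p && F p).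
  by apply: eq_Pr => p; rewrite /wins_from andbA andbC.
rewrite (order_event_exchangeable_indep oT xF) PF tE// -Pr_stops_by mulrC.
congr (_ * _); have <- : Pr (fun p : 'S_N => true) = 1 by apply: PrT.
rewrite (@PrD _ xpredT T (fun p => ~~ T p)); first by rewrite addrAC subrr add0r.
by move=> p; case: (T p).
Qed.

Lemma Pr_wins_step N K d1 d2 (u v : 'I_N) (a b : nat) :
  (0 < K)%N -> (d1 <= d2)%N -> top_two_values u v ->
  (d1 <= b)%N -> (b <= a)%N -> (a <= N)%N ->
  let W (x : int) (p : 'S_N) :=
    [&& d1%:Z < idx ((p^-1)%g u), d1%:Z < idx ((p^-1)%g v), wins K d1 d2 p &
        1 <= Num.min (idx ((p^-1)%g u)) (idx ((p^-1)%g v)) <= x] in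
  Pr (W a%:Z) = Pr (W b%:Z) + \sum_(i <- irange (b%:Z + 1) a%:Z)
     2 * ((N%:R - i%:~R) / (N%:R * (N%:R - 1))) * (1 - t N K d1 d2 i).
Proof.
move=> K0 d12 uv db ba aN W; rewrite (big_irange _ _ aN).
have -> : \sum_(i : 'I_N | b%:Z + 1 <= idx i <= a%:Z)
     2 * ((N%:R - (idx i)%:~R) / (N%:R * (N%:R - 1))) * (1 - t N K d1 d2 (idx i)) =
   \sum_(i | b%:Z + 1 <= idx i <= a%:Z) Pr (@wins_from N K d1 d2 i).
  by apply: eq_bigr => i _; rewrite (@Pr_wins_from _ _ _ _ u v).
pose first (p : 'S_N) :=
  if idx ((p^-1)%g u) < idx ((p^-1)%g v) then (p^-1)%g u else (p^-1)%g v.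
have firstP p : exists j, [/\ idx (first p) < idx j,
    top_two p (first p), top_two p j &
    forall k, top_two p k -> k = first p \/ k = j].
  have uv_neq : (p^-1)%g u != (p^-1)%g v.
    by rewrite (inj_eq perm_inj); case: uv.
  rewrite /first; have [lt|le] := ltrP (idx ((p^-1)%g u)).
    exists ((p^-1)%g v).
    split=> [//|||k]; rewrite (top_two_valuesP _ _ uv) ?eqxx ?orbT//.
    by move=> /orP[] /eqP; [left|right].
  exists ((p^-1)%g u).
  split=> [|||k]; rewrite ?(top_two_valuesP _ _ uv) ?eqxx ?orbT//.
    by rewrite lt_neqAle le (inj_eq (@idx_inj N)) eq_sym uv_neq.
  by move=> /orP[] /eqP; [right|left].
have W_first p : wins_from K d1 d2 (first p) p =
    ~~ stops_by K d1 d2 (idx (first p) - K%:Z) p.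
  have [j [ij pi pj ijP]] := firstP p.
  rewrite /wins_from pi /= andb_idl// => _; apply/forall_inP => k.
  by rewrite in_seen => kA; apply/negP => /ijP[] ek; move: kA ij; rewrite ek; lia.
have first_uniq p i : wins_from K d1 d2 i p -> i = first p.
  have [j [ij pi pj ijP]] := firstP p.
  move=> /and3P[/ijP[//|->] /forall_inP /(_ (first p))]; rewrite pi in_seen => fA _.
  by have : ~~ true by apply: fA; lia.
pose V (p : 'S_N) := (b%:Z + 1 <= idx (first p) <= a%:Z)
                     && wins_from K d1 d2 (first p) p.
rewrite -(@Pr_sum _ _ _ V); last first.
  move=> p.
  rewrite (@sum_nat_bool1 _ _ (fun i => wins_from K d1 d2 i p) (first p))//.
  by move=> i; apply: first_uniq.
apply: PrD => p; rewrite /W /V W_first.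
have [j [ij pi pj ijP]] := firstP p.
have -> : Num.min (idx ((p^-1)%g u)) (idx ((p^-1)%g v)) = idx (first p).
  by rewrite /first minElt; case: ifP.
have d1_first : (d1%:Z < idx ((p^-1)%g u)) && (d1%:Z < idx ((p^-1)%g v)) =
    (d1%:Z < idx (first p)).
  rewrite /first; have [lt|le] := ltrP (idx ((p^-1)%g u)) (idx ((p^-1)%g v)).
    by apply/andP/idP => [[]//|d1u]; split=> //; apply: lt_trans lt.
  by apply/andP/idP => [[]//|d1v]; split=> //; apply: lt_le_trans le.
rewrite !andbA d1_first; have [di|di] := lerP (idx (first p)) d1%:Z.
  by rewrite /= (_ : (b%:Z + 1 <= idx (first p)) = false)//; lia.
rewrite /= (wins_top_two K0 d12 di ij pi pj ijP).
case: (stops_by _ _ _ _ _) => /=; rewrite ?andbF//= ?andbT.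
by case: (lerP (idx (first p)) a%:Z); case: (lerP (idx (first p)) b%:Z);
  case: (lerP (b%:Z + 1) (idx (first p))) => //=; rewrite /idx; lia.
Qed.

Lemma index_of_rankE N (p : 'S_N) (z : 'I_N) :
  index_of_rank p z.+1 = idx ((p^-1)%g z).
Proof.
rewrite /index_of_rank; case: pickP => [i|/(_ ((p^-1)%g z))].
  by rewrite eqSS => /eqP/val_inj <-; rewrite permK.
by rewrite /rank permKV eqxx.
Qed.

Theorem theorem4p6 (N K d1 d2 a : nat)
  (hN : (2 <= N)%N) (hK : (1 <= K)%N) (hd : (d1 <= d2)%N) (ha : (a <= N)%N) :
  let q := ceil_div (a%:Z - d1%:Z) K in
  let s := ceil_div (a%:Z - d2%:Z) K in
  (0 < s ->
     sigma1 N K d1 d2 a%:Z =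
       sigma1 N K d1 d2 (d2%:Z + (s - 1) * K%:Z)
       + \sum_(i <- irange (d2%:Z + (s - 1) * K%:Z + 1) a%:Z)
           d1%:R / N%:R * (1 / (N%:R - 1)) * (1 - c N K d1 d2 i)) /\
  (0 < s ->
     sigma2 N K d1 d2 a%:Z =
       sigma2 N K d1 d2 (d2%:Z + (s - 1) * K%:Z)
       + \sum_(i <- irange (d2%:Z + (s - 1) * K%:Z + 1) a%:Z)
           d1%:R / N%:R * (1 / (N%:R - 1)) * (1 - c N K d1 d2 i)) /\
  (0 < q ->
     sigma3 N K d1 d2 a%:Z =
       sigma3 N K d1 d2 (d1%:Z + (q - 1) * K%:Z)
       + \sum_(i <- irange (d1%:Z + (q - 1) * K%:Z + 1) a%:Z)
           2 * ((N%:R - i%:~R) / (N%:R * (N%:R - 1))) * (1 - t N K d1 d2 i)).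
Proof.
move=> q s.
pose u := Ordinal (ltnW hN); pose v := Ordinal hN.
have uv : top_two_values u v by split=> // -[[|[|z]] zN].
have vu : top_two_values v u.
  by case: uv => + uv; split; [rewrite eq_sym | move=> z; rewrite uv orbC].
have j1E (p : 'S_N) : j1 p = idx ((p^-1)%g u) := index_of_rankE p u.
have j2E (p : 'S_N) : j2 p = idx ((p^-1)%g v) := index_of_rankE p v.
have start (d : nat) : 0 < ceil_div (a%:Z - d%:Z) K -> exists b : nat,
    [/\ d%:Z + (ceil_div (a%:Z - d%:Z) K - 1) * K%:Z = b%:Z, (d <= b)%N & (b <= a)%N].
  have := ceil_divP (a%:Z - d%:Z) hK; set n := ceil_div _ _ => /andP[n1 n2] n0.
  by exists `|(d%:Z + (n - 1) * K%:Z)%R|%N; split; nia.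
have sigma1E x : sigma1 N K d1 d2 x = Pr (fun p : 'S_N =>
    (idx ((p^-1)%g u) <= d1%:Z) && (d2%:Z < idx ((p^-1)%g v)) &&
    wins_choosing_by K d1 d2 x p).
  by apply: eq_Pr => p; rewrite j1E j2E.
have sigma2E x : sigma2 N K d1 d2 x = Pr (fun p : 'S_N =>
    (idx ((p^-1)%g v) <= d1%:Z) && (d1%:Z < idx ((p^-1)%g u)) &&
    wins_choosing_by K d1 d2 x p).
  by apply: eq_Pr => p; rewrite j1E j2E.
have sigma3E x : sigma3 N K d1 d2 x = Pr (fun p : 'S_N =>
    [&& d1%:Z < idx ((p^-1)%g u), d1%:Z < idx ((p^-1)%g v), wins K d1 d2 p &
        1 <= Num.min (idx ((p^-1)%g u)) (idx ((p^-1)%g v)) <= x]).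
  by apply: eq_Pr => p; rewrite j1E j2E.
split; [|split]; move=> /start[b [-> db ba]].
- by rewrite !sigma1E; apply: Pr_wins_choosing_by_step.
- by rewrite !sigma2E; apply: Pr_wins_choosing_by_step.
- by rewrite !sigma3E; apply: Pr_wins_step.
Qed.
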